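(* Let $\mathcal{R}_n$ be the (finite) set of random Apollonian network structures of order $n$ and $T_n=|\mathcal{R}_n|$. The average distance from $O_1$ in a RANS of order $n$ is of order $c\sqrt{n}$ with $c=\sqrt{3\pi}/11$; that is, as $n\to\infty$, $$\frac{1}{n\,T_n}\sum_{R\in\mathcal{R}_n}\ \sum_{v \text{ internal vertex of } R} d(v,O_1(R))\ \sim\ \frac{\sqrt{3\pi}}{11}\,\sqrt{n},$$ where $d$ is the graph distance in $R$.
   Context: A random Apollonian network structure (RANS) $R$ is defined recursively: it is either an empty triangle with ordered vertices $O_1(R),O_2(R),O_3(R)$ (mutually adjacent), or such a triangle together with a new vertex $c$ (the center of $R$) placed inside and joined to $O_1,O_2,O_3$, each of the three resulting sub-triangles being substituted by a RANS. The sub-RANS are $S_1(R),S_2(R),S_3(R)$, where $S_i(R)$ is the one whose triangle does not contain $O_i(R)$; the $i$-th outermost vertex of $S_i(R)$ is $c$ and its other outermost vertices are $O_j(R)$ in position $j$, $j\neq i$. The vertices $O_1(R),O_2(R),O_3(R)$ are the outermost vertices; all other vertices are internal. The order of the empty RANS is $0$, and the order of a non-empty RANS is one plus the sum of the orders of its three sub-RANS (so it is the number of internal vertices). A RANS of order $n\ge 1$ is thus determined by an ordered triple of RANS of total order $n-1$, i.e. RANS of order $n$ are in bijection with plane ternary trees with $n$ internal nodes. *)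

(* Defs.v *)
From HB Require Import structures.
From mathcomp Require Import all_boot all_order all_algebra.
From mathcomp Require Import all_classical all_reals all_analysis.

Set Implicit Arguments.
Unset Strict Implicit.
Unset Printing Implicit Defensive.

Inductive rans : Type :=
  | Empty
  | Node (S1 S2 S3 : rans).

Fixpoint rans_order (G : rans) : nat :=
  match G with
  | Empty => 0
  | Node S1 S2 S3 => (rans_order S1 + rans_order S2 + rans_order S3).+1
  end.

Fixpoint rans_tree (G : rans) : GenTree.tree unit :=
  match G with
  | Empty => GenTree.Node 0 [::]
  | Node S1 S2 S3 =>
      GenTree.Node 1 [:: rans_tree S1; rans_tree S2; rans_tree S3]
  end.

Fixpoint tree_rans (t : GenTree.tree unit) : rans :=
  match t with
  | GenTree.Node _ [:: t1; t2; t3] =>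
      Node (tree_rans t1) (tree_rans t2) (tree_rans t3)
  | _ => Empty
  end.

Lemma rans_treeK : cancel rans_tree tree_rans.
Proof. by elim=> //= S1 -> S2 -> S3 ->. Qed.

HB.instance Definition _ := Countable.copy rans (can_type rans_treeK).

(* A list containing every RANS whose ternary tree has height at most h. *)
Fixpoint rans_upto (h : nat) : seq rans :=
  if h is h'.+1 then
    Empty :: [seq Node t.1.1 t.1.2 t.2
             | t <- allpairs pair (allpairs pair (rans_upto h') (rans_upto h'))
                                  (rans_upto h')]
  else [:: Empty].

Lemma mem_rans_upto (h : nat) (G : rans) :
  rans_order G <= h -> G \in rans_upto h.
Proof.
elim: h G => [|h IHh] [|S1 S2 S3] //=; rewrite ltnS => leh.
have [le12 le3] : rans_order S1 + rans_order S2 <= h /\ rans_order S3 <= h.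
  by split; apply: leq_trans leh; [exact: leq_addr | exact: leq_addl].
rewrite inE; apply/orP; right; apply/mapP; exists (S1, S2, S3) => //.
apply: allpairs_f; last exact: IHh.
by apply: allpairs_f; apply: IHh; apply: leq_trans le12;
  [exact: leq_addr | exact: leq_addl].
Qed.

Definition rans_of (n : nat) := {G : rans | rans_order G == n}.
HB.instance Definition _ n := SubCountable.on (rans_of n).

Definition rans_of_enum (n : nat) : seq (rans_of n) :=
  undup (pmap insub (rans_upto n)).

Lemma rans_of_enumP (n : nat) : Finite.axiom (rans_of_enum n).
Proof.
apply: Finite.uniq_enumP; first exact: undup_uniq.
move=> G; rewrite mem_undup mem_pmap_sub; apply: mem_rans_upto.
by rewrite (eqP (valP G)).
Qed.

HB.instance Definition _ n :=
  fintype.isFinite.Build (rans_of n) (@rans_of_enumP n).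

(* [None] is the center. *)
Fixpoint internal (G : rans) : finType :=
  match G with
  | Empty => void
  | Node S1 S2 S3 => option (internal S1 + internal S2 + internal S3)%type
  end.

Definition vertex (G : rans) : finType := ('I_3 + internal G)%type.

(* [outer G i] is O_(i+1)(G): positions are numbered from 0. *)
Definition outer (G : rans) (i : 'I_3) : vertex G := inl i.
Definition O1 (G : rans) : vertex G := outer G ord0.

(* How the vertices of a sub-RANS are identified with vertices of the whole:
   the i-th outermost vertex of the i-th sub-RANS is the center. *)
Definition center (S1 S2 S3 : rans) : vertex (Node S1 S2 S3) := inr None.

Definition sub_outer (S1 S2 S3 : rans) (i j : 'I_3) : vertex (Node S1 S2 S3) :=
  if j == i then center S1 S2 S3 else outer _ j.

Definition emb1 (S1 S2 S3 : rans) (v : vertex S1) : vertex (Node S1 S2 S3) :=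
  match v with
  | inl j => sub_outer S1 S2 S3 (inord 0) j
  | inr x => inr (Some (inl (inl x)))
  end.

Definition emb2 (S1 S2 S3 : rans) (v : vertex S2) : vertex (Node S1 S2 S3) :=
  match v with
  | inl j => sub_outer S1 S2 S3 (inord 1) j
  | inr x => inr (Some (inl (inr x)))
  end.

Definition emb3 (S1 S2 S3 : rans) (v : vertex S3) : vertex (Node S1 S2 S3) :=
  match v with
  | inl j => sub_outer S1 S2 S3 (inord 2) j
  | inr x => inr (Some (inr x))
  end.

Definition image_rel (T T' : finType) (f : T -> T') (e : rel T) : rel T' :=
  fun u v => [exists x, exists y, [&& e x y, f x == u & f y == v]].

(* Every edge of the big triangle, and every edge joining the center to an
   outermost vertex, is a side of one of the three sub-triangles, so the edges
   are exactly those of the three sub-RANS (see [adj_outer], [adj_center]). *)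
Fixpoint adj (G : rans) : rel (vertex G) :=
  match G return rel (vertex G) with
  | Empty => fun u v => u != v
  | Node S1 S2 S3 => fun u v =>
      [|| image_rel (@emb1 S1 S2 S3) (@adj S1) u v,
          image_rel (@emb2 S1 S2 S3) (@adj S2) u v
        | image_rel (@emb3 S1 S2 S3) (@adj S3) u v]
  end.

Lemma adj_Node (S1 S2 S3 : rans) (u v : vertex (Node S1 S2 S3)) :
  adj u v = [|| image_rel (@emb1 S1 S2 S3) (@adj S1) u v,
                image_rel (@emb2 S1 S2 S3) (@adj S2) u v
              | image_rel (@emb3 S1 S2 S3) (@adj S3) u v].
Proof. by []. Qed.

Lemma adj_outer (G : rans) (i j : 'I_3) :
  adj (outer G i) (outer G j) = (i != j).
Proof.
elim: G i j => [|S1 IH1 S2 IH2 S3 IH3] i j //=.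
apply/idP/idP.
- case/or3P=> /existsP[x /existsP[y /and3P[]]];
  case: x => [a|a] //; case: y => [b|b] //;
  rewrite -!/(outer _ _) ?(IH1, IH2, IH3) /= /sub_outer;
  do 2?case: ifP => // _; by move=> ne /eqP[<-] /eqP[<-].
- move=> neij.
  have [k [nik njk]] : exists k : 'I_3, i != k /\ j != k.
    case: i j neij => [[|[|[|?]]] ?] // [[|[|[|?]]] ?] // _;
      by (exists (inord 0) + (exists (inord 1) + exists (inord 2)));
      rewrite -!val_eqE /= inordK.
  have e (m : nat) : inord m = k -> sub_outer S1 S2 S3 (inord m) i = outer _ i
      /\ sub_outer S1 S2 S3 (inord m) j = outer _ j.
    by move=> ->; rewrite /sub_outer (negPf nik) (negPf njk).
  have : (k == inord 0) || (k == inord 1) || (k == inord 2).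
    by case: k {nik njk e} => [[|[|[|?]]] ?] //;
      rewrite -!val_eqE /= !inordK.
  case/orP=> [/orP[]|] /eqP/esym/e[ei ej]; apply/or3P;
    [apply: Or31 | apply: Or32 | apply: Or33];
    apply/existsP; exists (outer _ i); apply/existsP; exists (outer _ j);
    by rewrite ?(IH1, IH2, IH3) neij /= ei ej !eqxx.
Qed.

Lemma adj_center (S1 S2 S3 : rans) (j : 'I_3) :
  adj (center S1 S2 S3) (outer _ j).
Proof.
have [k nkj] : exists k : 'I_3, k != j.
  by case: j => [[|[|[|?]]] ?] //;
    (exists (inord 0) + exists (inord 1)); rewrite -val_eqE /= inordK.
have e (m : nat) : inord m = k ->
    sub_outer S1 S2 S3 (inord m) k = center S1 S2 S3
    /\ sub_outer S1 S2 S3 (inord m) j = outer _ j.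
  by move=> ->; rewrite /sub_outer eqxx eq_sym (negPf nkj).
have : (k == inord 0) || (k == inord 1) || (k == inord 2).
  by case: k {nkj e} => [[|[|[|?]]] ?] //; rewrite -!val_eqE /= !inordK.
rewrite adj_Node.
case/orP=> [/orP[]|] /eqP/esym/e[ek ej]; apply/or3P;
  [apply: Or31 | apply: Or32 | apply: Or33];
  apply/existsP; exists (outer _ k); apply/existsP; exists (outer _ j);
  by rewrite adj_outer nkj /= ek ej !eqxx.
Qed.

(* The least number of edges of a walk from x to y. A shortest walk has fewer
   than #|T| edges; the value is #|T| when y is not reachable from x. *)
Definition dist (T : finType) (e : rel T) (x y : T) : nat :=
  find (fun k => [exists p : k.-tuple T, path e x p && (last x p == y)])
       (iota 0 #|T|).

Definition total_distance (G : rans) : nat :=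
  \sum_(x : internal G) dist (@adj G) (inr x) (O1 G).


Definition rans_count (n : nat) : nat := #|{: rans_of n}|.

Definition mean_distance (R : realType) (n : nat) : R :=
  ((n%:R * (rans_count n)%:R)^-1
   * \sum_(G : rans_of n) (total_distance (val G))%:R)%R.

(* Main.v *)
From HB Require Import structures.
Require Import Defs.
From mathcomp Require Import all_boot all_order all_algebra.
From mathcomp Require Import all_classical all_reals all_analysis.
From mathcomp Require Import ring lra zify.
Import Order.TTheory GRing.Theory Num.Theory.
Import numFieldNormedType.Exports.
Set Implicit Arguments.
Unset Strict Implicit.
Unset Printing Implicit Defensive.
Local Open Scope classical_set_scope.

(** Why the mean distance is asymptotic to [sqrt (3 pi) / 11 * sqrt n].

    Inside a triangle the distances to a source outside it depend only on the
    distances of its three corners: the centre is one further than the nearest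
    corner, and then it is a corner of the three sub-triangles ([dist_label]).
    Up to a permutation and a common shift, the corner distances (0,1,1) only
    produce (0,1,1), (0,0,0) and (0,0,1).  Splitting at the centre therefore
    gives a linear system ([gf_label_eq]) for the generating functions of the
    total distances, over the series [T = 1 + z T^3] of all RANS.  With
    [u = z T^2], so that [T = 1/(1 - u)] and [z = u (1 - u)^2], its solution
    for (0,1,1) is ([gf_label011_eq])

      [A = u T ((1 + 2 u^2) (1 - 3 u) + u (1 - u)) / ((1 - 3 u)^2 (1 + 2 u^2))].

    The dominant singularity is [z = 4/27], where [u = 1/3] and [T = 3/2].  The
    variable is rescaled, [z = (4/27) X], and [4 (1 - X)] then factors as
    [(1 - 3 u)^2 (4 - 3 u)]: as a function of [X], [(1 - 3 u)^2] has
    a simple zero at 1.  Hence [(1 - X) A] converges absolutely at 1, and its value there,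
    3/44, is the limit of the coefficients of [A] ([cf_gf_label_cvg]).  No
    complex analysis is involved: absolutely summable series form a ring on
    which evaluation at 1 is multiplicative ([abs_sumsM]).

    The number of RANS is read off [P = 1/(1 - 3 u)], whose coefficients are
    [2 n + 1] times those of [T].  The same factorization gives
    [P^2 = (1 - 3 u / 4) / (1 - X)], so that the coefficients of [P^2] tend to
    3/4.  On the other hand, the ratio of the coefficients of [P] to those of
    [Q = (1 - X)^(-1/2)] decreases, by the hypergeometric recurrence
    [cf_gfP_rec], hence has a limit [l]; since [Q^2 = 1/(1 - X)], the
    coefficients of [P^2] tend to [l^2] ([conv_sqr_ratio]) and
    [l = sqrt 3 / 2].  Finally the coefficients of [Q], the central binomial
    coefficients over powers of 4, are asymptotic to [1 / sqrt (pi n)] by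
    Wallis ([cbin_sqr_cvg]).  The mean distance is thus asymptotic to
    [(3/44) * 2 / ((sqrt 3 / 2) / sqrt (pi n))], as claimed. *)

(** * Distances to the first outermost vertex *)

(** The Lipschitz condition makes [D x] a lower bound for the length of walks
    from [x] to [y], and following descending edges attains it.  The descent
    visits vertices with distinct values of [D], hence is shorter than the
    number of vertices, which bounds the search in [dist]. *)
Lemma dist_eq (T : finType) (e : rel T) (y : T) (D : T -> nat) :
  D y = 0 ->
  (forall u v, e u v -> D u <= (D v).+1) ->
  (forall u, u != y -> exists2 v, e u v & D u = (D v).+1) ->
  forall x, dist e x y = D x.
Proof.
move=> Dy lip desc x.
(* Following descending edges from u reaches y in exactly D u steps *)
have walk u : exists p, [/\ path e u p, last u p = y, size p = D u,
    uniq (u :: p) & {in u :: p, forall v, D v <= D u}].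
  have [d] := ubnP (D u); elim: d u => // d IHd u; rewrite ltnS => ltd.
  have [->|/desc[v euv Duv]] := eqVneq u y.
    by exists [::]; split=> //= v; rewrite inE => /eqP ->.
  have [|p [pth lst sz un bnd]] := IHd v; first by rewrite -Duv.
  exists (v :: p); split=> //=; rewrite ?euv ?sz //.
    rewrite -/(uniq (v :: p)) un andbT; apply/negP => /bnd.
    by rewrite Duv ltnn.
  move=> w; rewrite inE => /predU1P[-> //|/bnd le]; rewrite Duv.
  exact: leqW.
have lower u p : path e u p -> last u p = y -> D u <= size p.
  elim: p u => [|v p IHp] u /=; first by move=> _ ->; rewrite Dy.
  move=> /andP[/lip le /IHp pv] /pv szp.
  by apply: (leq_trans le); rewrite ltnS.
have [p [pth lst sz un _]] := walk x.
have ltD : D x < #|T|.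
  by rewrite -sz -[_.+1]/(size (x :: p)) -(card_uniqP un) max_card.
rewrite /dist; set P := (fun k => [exists q : k.-tuple T, _]).
have PD : P (D x).
  apply/existsP; have szp : size p == D x by apply/eqP.
  by exists (Tuple szp); rewrite /= pth lst eqxx.
apply/eqP; rewrite eqn_leq; apply/andP; split.
  rewrite leqNgt; apply/negP => /(before_find 0).
  by rewrite nth_iota // PD.
have hP : has P (iota 0 #|T|) by apply/hasP; exists (D x); rewrite ?mem_iota.
have := nth_find 0 hP; move: hP; rewrite has_find size_iota => lt_f.
rewrite nth_iota // add0n => /existsP[q /andP[pq /eqP lq]].
by rewrite -[leqRHS](size_tuple q); apply: lower.
Qed.

(** The distances induced inside a triangle whose corners lie at distances
    [a], [b], [c] from the source: the centre is one further than the nearest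
    corner and then is a corner of the three sub-triangles. *)
Fixpoint label (G : rans) (a b c : nat) : internal G -> nat :=
  match G return internal G -> nat with
  | Defs.Empty => @of_void nat
  | Node S1 S2 S3 => fun x =>
      let m := (minn a (minn b c)).+1 in
      match x with
      | None => m
      | Some (inl (inl x)) => label m b c x
      | Some (inl (inr x)) => label a m c x
      | Some (inr x) => label a b m x
      end
  end.

Definition corner (a b c : nat) (j : 'I_3) : nat := nth 0 [:: a; b; c] j.

Definition label_vertex (G : rans) (a b c : nat) (v : vertex G) : nat :=
  match v with
  | inl j => corner a b c j
  | inr x => label a b c x
  end.

Section LabelNode.
Variables (S1 S2 S3 : rans) (a b c : nat).
Let m := (minn a (minn b c)).+1.
Let G := Node S1 S2 S3.

Lemma label_emb1 v :
  label_vertex a b c (@emb1 S1 S2 S3 v) = label_vertex m b c v.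
Proof.
case: v => [j|//] /=; rewrite /sub_outer -val_eqE /= inordK //.
by case: j => [[|[|[|?]]] ?].
Qed.

Lemma label_emb2 v :
  label_vertex a b c (@emb2 S1 S2 S3 v) = label_vertex a m c v.
Proof.
case: v => [j|//] /=; rewrite /sub_outer -val_eqE /= inordK //.
by case: j => [[|[|[|?]]] ?].
Qed.

Lemma label_emb3 v :
  label_vertex a b c (@emb3 S1 S2 S3 v) = label_vertex a b m v.
Proof.
case: v => [j|//] /=; rewrite /sub_outer -val_eqE /= inordK //.
by case: j => [[|[|[|?]]] ?].
Qed.

End LabelNode.

(** Satisfied by the distances at the corners of any triangle, which are
    pairwise adjacent. *)
Definition close (a b c : nat) :=
  [/\ a <= b.+1, a <= c.+1, b <= a.+1 & [/\ b <= c.+1, c <= a.+1 & c <= b.+1]].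

Lemma close_sub a b c (m := (minn a (minn b c)).+1) : close a b c ->
  [/\ close m b c, close a m c & close a b m].
Proof. rewrite /m /close; move=> [? ? ? [? ? ?]]; split; split; try split; lia. Qed.

(** Every edge of a RANS is an edge of an empty triangle of its decomposition,
    whose corners have close labels. *)
Lemma label_lipschitz G a b c (u v : vertex G) : close a b c ->
  adj u v -> label_vertex a b c u <= (label_vertex a b c v).+1.
Proof.
elim: G a b c u v => [|S1 IH1 S2 IH2 S3 IH3] a b c u v cl.
  case: cl => ? ? ? [? ? ?].
  case: u v => [[[|[|[|?]]] ?]|[]] // [[[|[|[|?]]] ?]|[]] // _; rewrite /corner /=; lia.
have [cl1 cl2 cl3] := close_sub cl.
rewrite adj_Node => /or3P[] /existsP[x /existsP[y /and3P[exy /eqP<- /eqP<-]]].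
- by rewrite !label_emb1; apply: IH1.
- by rewrite !label_emb2; apply: IH2.
- by rewrite !label_emb3; apply: IH3.
Qed.

(** A centre is adjacent to the three corners of its triangle, in particular to
    a nearest one. *)
Lemma label_descent G a b c (x : internal G) :
  exists2 v : vertex G, adj (inr x) v & label a b c x = (label_vertex a b c v).+1.
Proof.
elim: G a b c x => [|S1 IH1 S2 IH2 S3 IH3] a b c; first by case.
have emb_adj (S : rans) (f : vertex S -> vertex (Node S1 S2 S3)) y v :
    adj y v -> image_rel f (@adj S) (f y) (f v).
  by move=> yv; apply/existsP; exists y; apply/existsP; exists v; rewrite yv !eqxx.
case=> [[[x|x]|x]|].
- have [v xv lv] := IH1 (minn a (minn b c)).+1 b c x.
  exists (@emb1 S1 S2 S3 v); last by rewrite label_emb1 -lv.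
  by rewrite adj_Node (emb_adj _ (@emb1 S1 S2 S3) _ _ xv).
- have [v xv lv] := IH2 a (minn a (minn b c)).+1 c x.
  exists (@emb2 S1 S2 S3 v); last by rewrite label_emb2 -lv.
  by rewrite adj_Node (emb_adj _ (@emb2 S1 S2 S3) _ _ xv) orbT.
- have [v xv lv] := IH3 a b (minn a (minn b c)).+1 x.
  exists (@emb3 S1 S2 S3 v); last by rewrite label_emb3 -lv.
  by rewrite adj_Node (emb_adj _ (@emb3 S1 S2 S3) _ _ xv) !orbT.
- have [j cj] : exists j, corner a b c j = minn a (minn b c).
    by case: (leqP b c) => bc; case: leqP => abc;
      [exists (inord 0)|exists (inord 1)|exists (inord 0)|exists (inord 2)];
      rewrite /corner inordK //=.
  by exists (outer _ j); [exact: adj_center | rewrite /= cj].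
Qed.

Lemma dist_label G (x : internal G) : dist (@adj G) (inr x) (O1 G) = label 0 1 1 x.
Proof.
apply: (dist_eq (D := label_vertex 0 1 1)) => // [u v|[j|y]].
- exact: label_lipschitz.
- move=> j0; exists (O1 G); first by rewrite adj_outer.
  by case: j j0 => [[|[|[|?]]] ?].
- by move=> _; have [v] := label_descent 0 1 1 y; exists v.
Qed.

Local Open Scope ring_scope.

(** * Formal power series *)

(** A record and not a bare function: functions already carry the pointwise
    product. *)
Record fps (K : Type) := Fps { cf : nat -> K }.

Section FpsRing.
Variable K : comNzRingType.
Implicit Types f g h : fps K.

Lemma fpsP f g : (forall n, cf f n = cf g n) -> f = g.
Proof. by case: f g => [f] [g] /= fg; congr Fps; apply/funext. Qed.

HB.instance Definition _ := gen_eqMixin (fps K).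
HB.instance Definition _ := gen_choiceMixin (fps K).

Definition fps_zero : fps K := Fps (fun=> 0).
Definition fps_opp f := Fps (fun n => - cf f n).
Definition fps_add f g := Fps (fun n => cf f n + cf g n).

Fact fps_addA : associative fps_add.
Proof. by move=> f g h; apply: fpsP => n /=; rewrite addrA. Qed.
Fact fps_addC : commutative fps_add.
Proof. by move=> f g; apply: fpsP => n /=; rewrite addrC. Qed.
Fact fps_add0 : left_id fps_zero fps_add.
Proof. by move=> f; apply: fpsP => n /=; rewrite add0r. Qed.
Fact fps_addN : left_inverse fps_zero fps_opp fps_add.
Proof. by move=> f; apply: fpsP => n /=; rewrite addNr. Qed.

HB.instance Definition _ :=
  GRing.isZmodule.Build (fps K) fps_addA fps_addC fps_add0 fps_addN.

Definition fps_one : fps K := Fps (fun n => (n == 0)%:R).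
Definition fps_mul f g :=
  Fps (fun n => \sum_(i < n.+1) cf f i * cf g (n - i)).

(** A coefficient of a product depends on finitely many coefficients of the
    factors, so the ring axioms are inherited from polynomials. *)
Lemma fps_mul_poly f g (p q : {poly K}) n :
  (forall k, (k <= n)%N -> cf f k = p`_k) ->
  (forall k, (k <= n)%N -> cf g k = q`_k) ->
  forall k, (k <= n)%N -> cf (fps_mul f g) k = (p * q)`_k.
Proof.
move=> fp gq k kn; rewrite coefM; apply: eq_bigr => i _; congr (_ * _).
  by rewrite fp // (leq_trans (leq_ord i)).
by rewrite gq // (leq_trans (leq_subr _ _)).
Qed.

Lemma cf_trunc f n k : (k <= n)%N -> cf f k = (\poly_(i < n.+1) cf f i)`_k.
Proof. by move=> kn; rewrite coef_poly ltnS kn. Qed.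

Fact fps_mulC : commutative fps_mul.
Proof.
move=> f g; apply: fpsP => n; have tr h := @cf_trunc h n.
by rewrite !(fps_mul_poly (tr _) (tr _) (leqnn n)) mulrC.
Qed.

Fact fps_mulA : associative fps_mul.
Proof.
move=> f g h; apply: fpsP => n; have tr e := @cf_trunc e n.
rewrite (fps_mul_poly (tr f) (fps_mul_poly (tr g) (tr h)) (leqnn n)).
by rewrite (fps_mul_poly (fps_mul_poly (tr f) (tr g)) (tr h) (leqnn n)) mulrA.
Qed.

Fact fps_mul1 : left_id fps_one fps_mul.
Proof.
move=> f; apply: fpsP => n /=; rewrite big_ord_recl /= mul1r subn0.
by rewrite big1 ?addr0 // => i _; rewrite mul0r.
Qed.

Fact fps_mulD : left_distributive fps_mul fps_add.
Proof.
move=> f g h; apply: fpsP => n /=; rewrite -big_split /=.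
by apply: eq_bigr => i _; rewrite mulrDl.
Qed.

Fact fps_one_neq0 : fps_one != fps_zero.
Proof.
by apply/eqP => /(congr1 (fun f => cf f 0))/eqP /=; rewrite oner_eq0.
Qed.

HB.instance Definition _ := GRing.Zmodule_isComNzRing.Build (fps K)
  fps_mulA fps_mulC fps_mul1 fps_mulD fps_one_neq0.

Lemma cfD f g n : cf (f + g) n = cf f n + cf g n. Proof. by []. Qed.
Lemma cfN f n : cf (- f) n = - cf f n. Proof. by []. Qed.
Lemma cfB f g n : cf (f - g) n = cf f n - cf g n. Proof. by []. Qed.
Lemma cf1 n : cf (1 : fps K) n = (n == 0)%:R. Proof. by []. Qed.
Lemma cfM f g n :
  cf (f * g) n = \sum_(i < n.+1) cf f i * cf g (n - i).
Proof. by []. Qed.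

Lemma cf_natl k f n : cf (k%:R * f) n = k%:R * cf f n.
Proof.
rewrite !mulr_natl; elim: k => [|k IHk]; first by rewrite !mulr0n.
by rewrite !mulrS cfD IHk.
Qed.

Definition monomial (c : K) : fps K := Fps (fun n => if n == 1 then c else 0).

Lemma cf_monomialM c f n :
  cf (monomial c * f) n = if n is n'.+1 then c * cf f n' else 0.
Proof.
rewrite cfM; case: n => [|n]; first by rewrite big_ord1 mul0r.
rewrite !big_ord_recl /= mul0r add0r subn1 big1 ?addr0 // => i _.
by rewrite mul0r.
Qed.

Definition geom : fps K := Fps (fun=> 1).

(** Multiplication by [geom] takes partial sums and [1 - X] undoes it. *)
Lemma mul_geom : (1 - monomial 1) * geom = 1.
Proof.
apply: fpsP => n; rewrite mulrBl mul1r cfB cf_monomialM cf1.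
by case: n => [|n]; rewrite ?subr0 ?mul1r ?subrr.
Qed.

Lemma cf_geom f n : cf (f * geom) n = \sum_(i < n.+1) cf f i.
Proof. by rewrite cfM; apply: eq_bigr => i _; rewrite mulr1. Qed.

(** The Euler operator [x d/dx]. *)
Definition theta f := Fps (fun n => n%:R * cf f n).

Lemma cf_theta f n : cf (theta f) n = n%:R * cf f n. Proof. by []. Qed.

Lemma thetaD f g : theta (f + g) = theta f + theta g.
Proof. by apply: fpsP => n /=; rewrite mulrDr. Qed.

Lemma thetaN f : theta (- f) = - theta f.
Proof. by apply: fpsP => n /=; rewrite mulrN. Qed.

Lemma thetaM f g : theta (f * g) = theta f * g + f * theta g.
Proof.
apply: fpsP => n; rewrite cfD !cfM /= mulr_sumr -big_split /=.
apply: eq_bigr => i _; have le_in : (i <= n)%N by rewrite -ltnS.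
have -> : n%:R = i%:R + (n - i)%:R :> K by rewrite -natrD subnKC.
by ring.
Qed.

Lemma theta_nat k : theta k%:R = 0.
Proof.
apply: fpsP => n; rewrite -[k%:R]mulr1 -[LHS]/(n%:R * cf _ n) cf_natl cf1.
by case: n => [|n]; rewrite ?mul0r ?mulr0.
Qed.

Lemma theta_monomial c : theta (monomial c) = monomial c.
Proof. by apply: fpsP => -[|[|n]] /=; rewrite ?mul1r ?mulr0. Qed.

(** A series without constant term is topologically nilpotent. *)
Lemma fps_fixed_eq0 f g : cf f 0 = 0 -> g = f * g -> g = 0.
Proof.
move=> f0 gE; apply: fpsP => n; elim/ltn_ind: n => n IHn.
rewrite gE cfM big_ord_recl f0 mul0r add0r big1 // => i _.
rewrite IHn ?mulr0 // lift0 ltn_subrL /=.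
by rewrite (leq_ltn_trans (leq0n i)).
Qed.

End FpsRing.

(** * Absolutely summable series *)

Section Toeplitz.
Variable R : realType.

(** A matrix with bounded row sums whose columns tend to 0 transforms null
    sequences into null sequences: the tail of the sequence is uniformly small,
    and the head meets finitely many columns. *)
Lemma toeplitz (c : nat -> nat -> R) (e : nat -> R) (M : R) :
  (forall n, \sum_(k < n.+1) `|c n k| <= M) ->
  (forall k, c n k @[n --> \oo] --> 0) ->
  e n @[n --> \oo] --> 0 ->
  (\sum_(k < n.+1) c n k * e k) @[n --> \oo] --> 0.
Proof.
move=> cM c0 e0; apply/cvgrPdist_lt => eps eps0.
have M0 : 0 <= M by apply: le_trans (cM 0%N); apply: sumr_ge0.
pose d := eps / 2 / (M + 1).
have d0 : 0 < d by rewrite !divr_gt0 // ltr_wpDl.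
have [N _ eN] : \forall n \near \oo, `|e n| < d by exact: (cvgr0_norm_lt _ e0).
have head0 : (\sum_(0 <= k < N) `|c n k * e k|) @[n --> \oo] --> 0.
  rewrite -[X in _ --> X](@big1 R 0 +%R _ (index_iota 0 N) xpredT (fun=> 0)) //.
  apply: cvg_big => [|k _]; first exact: add_continuous.
  rewrite -(normr0 R) -(mul0r (e k)); apply: cvg_norm.
  by apply: cvgM; [exact: c0 | exact: cvg_cst].
near=> n.
have Nn : (N <= n.+1)%N by near: n; exists N => // m /= /leqW.
rewrite sub0r normrN; apply: le_lt_trans (ler_norm_sum _ _ _) _.
rewrite -(big_mkord xpredT (fun k => `|c n k * e k|)) (big_cat_nat (leq0n N) Nn) //=.
rewrite (splitr eps) ltr_leD //.
  rewrite -[ltLHS]ger0_norm ?sumr_ge0 //.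
  by near: n; apply: (cvgr0_norm_lt _ head0); rewrite divr_gt0.
apply: (@le_trans _ _ (\sum_(N <= k < n.+1) `|c n k| * d)).
  rewrite !big_nat; apply: ler_sum => k /andP[Nk _].
  by rewrite normrM ler_wpM2l // ltW // eN.
rewrite -mulr_suml; apply: (@le_trans _ _ (M * d)).
  rewrite ler_wpM2r ?(ltW d0) //; apply: le_trans (cM n).
  rewrite -(big_mkord xpredT (fun k => `|c n k|)) (big_cat_nat (leq0n N) Nn) //=.
  by rewrite lerDr sumr_ge0.
by rewrite /d mulrCA ger_pMr ?divr_gt0 // ler_pdivrMr ?mul1r ?lerDl // ltr_wpDl.
Unshelve. all: by end_near. Qed.

End Toeplitz.

Section AbsSums.
Variable R : realType.
Implicit Types f g h : fps R.

Definition psum f n := \sum_(i < n.+1) cf f i.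
Definition fps_norm f := Fps (fun n => `|cf f n|).

(** The series of the Wiener algebra, with their values at 1.  This relation is
    compatible with the ring operations, so that identities between series can
    be evaluated at the singularity. *)
Definition abs_sums f (s : R) :=
  (exists M, forall n, psum (fps_norm f) n <= M) /\ psum f n @[n --> \oo] --> s.

Lemma psumE f n : psum f n = cf (f * geom R) n.
Proof. by rewrite cf_geom. Qed.

Lemma psumS f n : psum f n.+1 = psum f n + cf f n.+1.
Proof. by rewrite /psum big_ord_recr. Qed.

Lemma psumD f g n : psum (f + g) n = psum f n + psum g n.
Proof. by rewrite /psum big_split. Qed.

Lemma psumN f n : psum (- f) n = - psum f n.
Proof. by rewrite /psum sumrN. Qed.

Lemma psumM f g n : psum (f * g) n = \sum_(k < n.+1) cf f k * psum g (n - k).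
Proof.
rewrite psumE -mulrA cfM; apply: eq_bigr => k _.
by rewrite -psumE.
Qed.

Lemma psum_le f g n : (forall k, cf f k <= cf g k) -> psum f n <= psum g n.
Proof. by move=> fg; apply: ler_sum. Qed.

Lemma psum_homo f : (forall k, 0 <= cf f k) -> 
  {homo psum f : m n / (m <= n)%N >-> m <= n}.
Proof.
move=> f0; apply: homo_leq => [//|y x z|n]; first exact: le_trans.
by rewrite psumS lerDl.
Qed.

Lemma psum_ge0 f n : (forall k, 0 <= cf f k) -> 0 <= psum f n.
Proof. by move=> f0; apply: sumr_ge0. Qed.

Lemma cf_norm f k : cf (fps_norm f) k = `|cf f k|. Proof. by []. Qed.

Lemma cf_norm_ge0 f k : 0 <= cf (fps_norm f) k.
Proof. exact: normr_ge0. Qed.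

Lemma psum_norm_ge0 f n : 0 <= psum (fps_norm f) n.
Proof. exact/psum_ge0/cf_norm_ge0. Qed.

Lemma psum_norm_id f : (forall k, 0 <= cf f k) -> fps_norm f = f.
Proof. by move=> f0; apply: fpsP => n /=; rewrite ger0_norm. Qed.

Lemma cfM_ge0 f g : (forall k, 0 <= cf f k) -> (forall k, 0 <= cf g k) ->
  forall k, 0 <= cf (f * g) k.
Proof. by move=> f0 g0 k; rewrite cfM sumr_ge0 // => i _; rewrite mulr_ge0. Qed.

Lemma psumM_le f g n : (forall k, 0 <= cf f k) -> (forall k, 0 <= cf g k) ->
  psum (f * g) n <= psum f n * psum g n.
Proof.
move=> f0 g0; rewrite psumM mulr_suml; apply: ler_sum => k _.
by rewrite ler_wpM2l // psum_homo // leq_subr.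
Qed.

Lemma psum_normM f g n :
  psum (fps_norm (f * g)) n <= psum (fps_norm f * fps_norm g) n.
Proof.
apply: psum_le => k; rewrite [leLHS]/= cfM; apply: le_trans (ler_norm_sum _ _ _) _.
by apply: ler_sum => i _; rewrite normrM.
Qed.

Lemma abs_sums_unique f s t : abs_sums f s -> abs_sums f t -> s = t.
Proof. by move=> [_ fs] [_ ft]; apply: (cvg_unique _ fs ft). Qed.

Lemma abs_sums_cf0 f s : abs_sums f s -> cf f n @[n --> \oo] --> 0.
Proof.
move=> [_ fs].
have fs' : psum f n.+1 @[n --> \oo] --> s by rewrite (cvg_shiftS (psum f)).
suff : [sequence cf f n.+1]_n @ \oo --> s - s by rewrite subrr (cvg_shiftS (cf f)).
rewrite (_ : [sequence _]_n = psum f \o succn - psum f); first exact: cvgB.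
by apply/funext => n; rewrite /= -[RHS]/(psum f n.+1 - psum f n) psumS addrC addKr.
Qed.

Lemma abs_sums_nat k : abs_sums k%:R k%:R.
Proof.
have psum_nat n : psum k%:R n = k%:R :> R.
  rewrite psumE cf_natl /=; case: k => [|k]; rewrite ?mul0r //.
  by rewrite mulr1.
split; last by rewrite (funext psum_nat); apply: cvg_cst.
exists k%:R => n; rewrite psum_norm_id ?psum_nat // => i.
by rewrite -[k%:R]mulr1 cf_natl mulr_ge0.
Qed.

Lemma abs_sumsD f g s t : abs_sums f s -> abs_sums g t -> abs_sums (f + g) (s + t).
Proof.
move=> [[M fM] fs] [[P gP] gt]; split.
  exists (M + P) => n; apply: le_trans (lerD (fM n) (gP n)).
  by rewrite -psumD; apply: psum_le => k /=; exact: ler_normD.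
by rewrite (_ : psum _ = psum f \+ psum g); [exact: cvgD | apply/funext/psumD].
Qed.

Lemma abs_sumsN f s : abs_sums f s -> abs_sums (- f) (- s).
Proof.
move=> [[M fM] fs]; split.
  by exists M => n; apply: le_trans (fM n); apply: psum_le => k /=; rewrite normrN.
by rewrite (_ : psum _ = \- psum f); [exact: cvgN | apply/funext/psumN].
Qed.

Lemma abs_sumsB f g s t : abs_sums f s -> abs_sums g t -> abs_sums (f - g) (s - t).
Proof. by move=> fs gt; apply: abs_sumsD => //; apply: abs_sumsN. Qed.

(** Mertens: [psum (f * g) n - (psum f n) t] is the transform of the null
    sequence [psum g k - t] by the matrix [cf f (n - k)]. *)
Lemma abs_sumsM f g s t : abs_sums f s -> abs_sums g t -> abs_sums (f * g) (s * t).
Proof.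
move=> fs gt; have f0 := abs_sums_cf0 fs; case: fs gt => [[M fM] fs] [[P gP] gt].
split.
  exists (M * P) => n; apply: le_trans (psum_normM _ _ _) _.
  apply: le_trans (psumM_le _ (cf_norm_ge0 f) (cf_norm_ge0 g)) _.
  by apply: ler_pM => //; apply: psum_norm_ge0.
have -> : psum (f * g) = fun n =>
    \sum_(k < n.+1) cf f (n - k) * (psum g k - t) + psum f n * t.
  apply/funext => n; rewrite mulr_suml (reindex_inj rev_ord_inj) /=.
  rewrite -big_split /= psumM; apply: eq_bigr => k _.
  by rewrite subSS subKn ?leq_ord //; ring.
rewrite -[s * t]add0r; apply: cvgD; last by apply: cvgMl.
apply: (@toeplitz _ (fun n k => cf f (n - k)) (fun k => psum g k - t) M).
- move=> n; apply: le_trans (fM n).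
  rewrite (reindex_inj rev_ord_inj) /= le_eqVlt; apply/orP; left; apply/eqP.
  by apply: eq_bigr => k _; rewrite subSS subKn ?leq_ord.
- move=> k; rewrite -(cvg_shiftn k).
  by under eq_fun do rewrite addnK.
- by rewrite -(subrr t); apply: cvgB => //; apply: cvg_cst.
Qed.

Lemma abs_sums_norm f M :
  (forall n, psum (fps_norm f) n <= M) -> exists s, abs_sums f s.
Proof.
move=> fM.
have psum_series h : psum h = (fun n => series (cf h) n.+1).
  by apply/funext => n; rewrite /series /= big_mkord.
have cn : cvgn (psum (fps_norm f)).
  apply: nondecreasing_is_cvgn; first by apply: psum_homo => k /=.
  by exists M => _ [n _ <-].
have cf_ : cvgn (series (cf f)).
  apply: normed_cvg; apply/cvg_ex; case/cvg_ex: cn => s ns; exists s.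
  by rewrite -cvg_shiftS /=; move: ns; rewrite psum_series.
case/cvg_ex: cf_ => s cs; exists s; split; first by exists M.
by rewrite psum_series (cvg_shiftS (series (cf f))).
Qed.

(** The norms of partial sums of [f] are at most those of [g] plus [M] times
    themselves. *)
Lemma abs_sums_contract f g k s M : abs_sums g s ->
  (forall n, psum (fps_norm k) n <= M) -> M < 1 -> f = g + k * f ->
  exists t, abs_sums f t.
Proof.
move=> [[P gP] _] kM M1 fE; apply: (@abs_sums_norm _ (P / (1 - M))) => n.
rewrite ler_pdivlMr ?subr_gt0 // mulrBr mulr1 lerBlDr mulrC.
apply: (@le_trans _ _ (psum (fps_norm g) n + psum (fps_norm (k * f)) n)).
  by rewrite -psumD; apply: psum_le => i /=; rewrite {1}fE; exact: ler_normD.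
apply: lerD => //; apply: le_trans (psum_normM _ _ _) _.
apply: le_trans (psumM_le _ (cf_norm_ge0 k) (cf_norm_ge0 f)) _.
by apply: ler_wpM2r => //; apply: psum_norm_ge0.
Qed.

End AbsSums.

(** * Generating functions of RANS *)

Lemma sum_option (I : finType) (F : option I -> nat) :
  (\sum_x F x = F None + \sum_(x : I) F (Some x))%N.
Proof.
rewrite (bigD1 None) //=; congr addn.
rewrite (reindex_omap Some id) => [|[x|] //]; apply: eq_bigl => x.
by rewrite eqxx.
Qed.

Definition total_label (G : rans) (a b c : nat) : nat :=
  (\sum_(x : internal G) label a b c x)%N.

Lemma total_distanceE G : total_distance G = total_label G 0 1 1.
Proof. by apply: eq_bigr => x _; apply: dist_label. Qed.

Lemma total_label_Node S1 S2 S3 a b c (m := (minn a (minn b c)).+1) :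
  total_label (Node S1 S2 S3) a b c =
  (m + total_label S1 m b c + total_label S2 a m c + total_label S3 a b m)%N.
Proof. by rewrite /total_label sum_option !big_sumType /= !addnA. Qed.

Lemma total_label_Empty a b c : total_label Defs.Empty a b c = 0%N.
Proof. by apply: big1; case. Qed.

(** Moving the source one step further away adds 1 for each internal vertex. *)
Lemma total_label_shift G a b c :
  total_label G a.+1 b.+1 c.+1 = (total_label G a b c + rans_order G)%N.
Proof.
elim: G a b c => [|S1 IH1 S2 IH2 S3 IH3] a b c; first by rewrite !total_label_Empty.
by rewrite !total_label_Node /= !minnSS IH1 IH2 IH3; lia.
Qed.

Lemma rans_upto_uniq h : uniq (rans_upto h).
Proof.
elim: h => [//|h IHh] /=; apply/andP; split; first by apply/mapP => -[].
rewrite map_inj_uniq; last by move=> [[? ?] ?] [[? ?] ?] /= [-> -> ->].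
by rewrite !allpairs_uniq // => -[? ?] [? ?] _ _ [-> ->].
Qed.

Lemma sum_rans_of (V : nmodType) (f : rans -> V) n h : (n <= h)%N ->
  \sum_(G : rans_of n) f (val G) = \sum_(G <- rans_upto h | rans_order G == n) f G.
Proof.
move=> nh; rewrite -big_enum -[LHS](big_map val xpredT f) -[RHS]big_filter.
apply: perm_big; apply: uniq_perm.
- by rewrite map_inj_uniq ?enum_uniq //; exact: val_inj.
- by rewrite filter_uniq // rans_upto_uniq.
move=> G; rewrite mem_filter; apply/mapP/andP => [[S _ ->]|[Gn _]].
  split; first exact: valP S.
  by apply: mem_rans_upto; rewrite (eqP (valP S)).
by exists (exist _ G Gn); rewrite ?mem_enum.
Qed.

Section GeneratingFunctions.
Variable R : realType.
Implicit Types f : rans -> R.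

(** The variable is scaled by the radius of convergence 4/27, so that the
    dominant singularity lies at 1. *)
Definition rho : R := 4 / 27.
Definition gf f : fps R :=
  Fps (fun n => \sum_(G : rans_of n) rho ^+ n * f (val G)).

Definition gf_poly h f : {poly R} :=
  \sum_(G <- rans_upto h) (rho ^+ rans_order G * f G) *: 'X^(rans_order G).

Lemma cf_gf f n h : (n <= h)%N -> cf (gf f) n = (gf_poly h f)`_n.
Proof.
move=> nh; rewrite /= (sum_rans_of (fun G => rho ^+ n * f G) nh) coef_sum big_mkcond.
apply: eq_bigr => G _; rewrite coefZ coefXn eq_sym.
by case: eqP => [->|]; rewrite ?mulr1 ?mulr0.
Qed.

Lemma eq_gf f g : f =1 g -> gf f = gf g.
Proof. by move=> fg; apply: fpsP => n; apply: eq_bigr => G _; rewrite fg. Qed.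

Lemma gfD f g : gf (fun G => f G + g G) = gf f + gf g.
Proof.
apply: fpsP => n; rewrite cfD /= -big_split /=.
by apply: eq_bigr => G _; rewrite mulrDr.
Qed.

Lemma gf_natl k f : gf (fun G => k%:R * f G) = k%:R * gf f.
Proof.
apply: fpsP => n; rewrite cf_natl /= mulr_sumr; apply: eq_bigr => G _.
by rewrite mulrCA.
Qed.

Lemma gf_order f : gf (fun G => (rans_order G)%:R * f G) = theta (gf f).
Proof.
apply: fpsP => n /=; rewrite mulr_sumr; apply: eq_bigr => G _.
by rewrite (eqP (valP G)) mulrCA.
Qed.

Definition on_Empty G : R := if G is Node _ _ _ then 0 else 1.
Definition on_Node f1 f2 f3 G : R :=
  if G is Node S1 S2 S3 then f1 S1 * f2 S2 * f3 S3 else 0.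

Lemma gf_Empty : gf on_Empty = 1.
Proof.
apply: fpsP => n; rewrite cf1 /=; case: n => [|n].
  rewrite (sum_rans_of (fun G => rho ^+ 0 * on_Empty G) (leqnn 0)).
  by rewrite /= big_cons big_nil /= addr0 expr0 mulr1.
apply: big1 => -[[|S1 S2 S3] //= _] _; by rewrite mulr0.
Qed.

(** Splitting a RANS at its centre turns sums of products into products. *)
Lemma gf_Node f1 f2 f3 :
  gf (on_Node f1 f2 f3) = monomial rho * (gf f1 * gf f2 * gf f3).
Proof.
apply: fpsP => -[|n]; rewrite cf_monomialM.
  by apply: big1 => -[[|S1 S2 S3] //= _] _; rewrite mulr0.
have tr f k : (k <= n)%N -> cf (gf f) k = (gf_poly n f)`_k by apply: cf_gf.
rewrite (fps_mul_poly (fps_mul_poly (tr f1) (tr f2)) (tr f3) (leqnn n)).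
rewrite (cf_gf _ (leqnn _)) (_ : gf_poly n.+1 (on_Node f1 f2 f3) =
    'X * (rho *: (gf_poly n f1 * gf_poly n f2 * gf_poly n f3))).
  by rewrite coefXM coefZ.
have mulZX (a b : R) i j :
    (a *: 'X^i) * (b *: 'X^j) = (a * b) *: 'X^(i + j) :> {poly R}.
  by rewrite -scalerAl -scalerAr scalerA exprD.
rewrite {1}/gf_poly /= big_cons mulr0 scale0r add0r big_map !big_allpairs /=.
rewrite /gf_poly big_distrlr /= mulr_suml scaler_sumr mulr_sumr.
apply: eq_bigr => S1 _; rewrite mulr_suml scaler_sumr mulr_sumr.
apply: eq_bigr => S2 _; rewrite mulr_sumr scaler_sumr mulr_sumr.
apply: eq_bigr => S3 _; rewrite !mulZX scalerA.
rewrite -[in RHS]scalerAr -[in RHS]exprS /=.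
by congr (_ *: 'X^_); rewrite exprS !exprD; ring.
Qed.

End GeneratingFunctions.

(** * The linear system of distances and the hypergeometric equation *)

(** Elimination in the linear system satisfied by the generating functions of
    the sums of labels, up to permutation of the corner labels
    (0,1,1), (0,0,0), (0,0,1). *)
Lemma label_system_solution (K : comNzRingType) (A B1 B2 B3 C N u w : K) :
  A = 1%:R * w + u * (C + N + A + A) ->
  C = 1%:R * w + u * (B1 + B2 + B3) ->
  B1 = 1%:R * w + u * (B1 + A + A) ->
  B2 = 1%:R * w + u * (A + B2 + A) ->
  B3 = 1%:R * w + u * (A + A + B3) ->
  N * (1 - 3%:R * u) = w ->
  A * (1 - 3%:R * u) * (1 - 3%:R * u) * (1 + 2%:R * u * u) =
  w * ((1 + 2%:R * u * u) * (1 - 3%:R * u) + u * (1 - u)).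
Proof.
have sub0 (x y : K) : x = y -> x - y = 0 by move=> ->; rewrite subrr.
move=> /sub0 eA /sub0 eC /sub0 eB1 /sub0 eB2 /sub0 eB3 /sub0 eN.
apply: subr0_eq.
pose e := 1 - 3%:R * u.
(* Each 0 stands for one equation of the system, next to its cofactor *)
transitivity (e * ((1 - u) * 0 + u * (1 - u) * 0 + u * u * (0 + 0 + 0))
  + u * (1 - u) * 0).
  by rewrite -{1}eA -{1}eC -{1}eB1 -{1}eB2 -{1}eB3 -{1}eN /e; ring.
by ring.
Qed.

Section System.
Variable R : realType.

Local Notation z := (monomial (rho R)).

Definition gfT : fps R := gf (fun=> 1).
Definition gfN : fps R := theta gfT.
Definition gfU : fps R := z * gfT * gfT.
Definition gf_label a b c : fps R := gf (fun G => (total_label G a b c)%:R).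

Local Notation T := gfT.
Local Notation N := gfN.
Local Notation u := gfU.

Lemma gfT_eq : T = 1 + z * (T * T * T).
Proof.
rewrite {1}/gfT -gf_Empty -gf_Node -gfD; apply: eq_gf => -[|S1 S2 S3] /=.
  by rewrite addr0.
by rewrite add0r !mulr1.
Qed.

Lemma gfN_eq : N = u * T + 3%:R * u * N.
Proof.
have NE : N = gf (fun G => (rans_order G)%:R).
  by rewrite /gfN -gf_order; apply: eq_gf => G; rewrite mulr1.
pose o G : R := (rans_order G)%:R.
have -> : u * T + 3%:R * u * N = z * (T * T * T) + z * (N * T * T)
    + z * (T * N * T) + z * (T * T * N) by rewrite /gfU; ring.
rewrite NE -!gf_Node -!gfD; apply: eq_gf => -[|S1 S2 S3] /=.
  by rewrite !addr0.
by rewrite -natr1 !natrD; ring.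
Qed.

Lemma gf_label_eq m a b c : minn a (minn b c) = m ->
  gf_label a b c = m.+1%:R * (u * T)
    + u * (gf_label m.+1 b c + gf_label a m.+1 c + gf_label a b m.+1).
Proof.
move=> mE; have split_u (k L1 L2 L3 : fps R) : k * (u * T) + u * (L1 + L2 + L3) =
    k * (z * (T * T * T)) + z * (L1 * T * T) + z * (T * L2 * T) + z * (T * T * L3).
  by rewrite /gfU; ring.
rewrite split_u -!gf_Node -gf_natl -!gfD; apply: eq_gf => -[|S1 S2 S3] /=.
  by rewrite total_label_Empty mulr0 !addr0.
by rewrite total_label_Node mE !natrD !mulr1 !mul1r.
Qed.

Lemma gf_label_shift a b c : gf_label a.+1 b.+1 c.+1 = gf_label a b c + N.
Proof.
rewrite /gfN -gf_order -gfD; apply: eq_gf => G.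
by rewrite mulr1 -natrD total_label_shift.
Qed.

Lemma cf_gfT0 : cf T 0 = 1.
Proof. by rewrite gfT_eq cfD cf_monomialM addr0. Qed.

Lemma gfT_inv : T * (1 - u) = 1.
Proof. by rewrite /gfU mulrBr mulr1 {1}gfT_eq; ring. Qed.

(** The uniformization of the equation [T = 1 + z T^3]. *)
Lemma z_eq : z = u * (1 - u) * (1 - u).
Proof.
have -> : u * (1 - u) * (1 - u) = z * (T * (1 - u)) * (T * (1 - u)).
  by rewrite {1}/gfU; ring.
by rewrite gfT_inv !mulr1.
Qed.

(** [u = 1/3] is the critical point of [z = u (1 - u)^2], hence a double root of
    the equation [z = 4/27]. *)
Lemma one_minus_X : 4%:R * (1 - monomial 1) =
  (1 - 3%:R * u) * (1 - 3%:R * u) * (4%:R - 3%:R * u).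
Proof.
have -> : 4%:R * (1 - monomial 1) = 4%:R - 27%:R * z.
  apply: fpsP => n; rewrite mulrBr mulr1 !cfB !cf_natl /= /rho.
  by case: (n == 1); congr (_ - _); field.
by rewrite z_eq; ring.
Qed.

(** The series [1/(1 - 3u)], whose coefficients are the binomial coefficients
    [C(3n, n)] scaled by [rho ^ n]. *)
Definition gfP : fps R := T + 2%:R * N.
Local Notation p := gfP.

Lemma gfN_mul : N * (1 - 3%:R * u) = u * T.
Proof. by rewrite mulrBr mulr1 {1}gfN_eq; ring. Qed.

Lemma gfP_inv : p * (1 - 3%:R * u) = 1.
Proof. by rewrite /gfP mulrDl -mulrA gfN_mul -[RHS]gfT_inv; ring. Qed.

Lemma coef_gfU0 : cf u 0 = 0.
Proof. by rewrite /gfU -mulrA cf_monomialM. Qed.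

(** Permuting the corners permutes the RANS; algebraically, the three series
    solve the same equation [f = ... + 2 u f], which has one solution. *)
Lemma gf_label_sym :
  gf_label 1 0 1 = gf_label 0 1 1 /\ gf_label 1 1 0 = gf_label 0 1 1.
Proof.
have eqA f : f = u * T + u * (gf_label 1 1 1 + f + f) -> f = gf_label 0 1 1.
  move=> fE; apply/eqP; rewrite -subr_eq0; apply/eqP.
  apply: (@fps_fixed_eq0 _ (2%:R * u)); first by rewrite cf_natl coef_gfU0 mulr0.
  by rewrite {1}fE {1}(@gf_label_eq 0 0 1 1 erefl); ring.
split; apply: eqA.
  by rewrite {1}(@gf_label_eq 0 1 0 1 erefl) /=; ring.
by rewrite {1}(@gf_label_eq 0 1 1 0 erefl) /=; ring.
Qed.

Lemma gf_label011_eq (A := gf_label 0 1 1) :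
  A * (1 - 3%:R * u) * (1 - 3%:R * u) * (1 + 2%:R * u * u) =
  u * T * ((1 + 2%:R * u * u) * (1 - 3%:R * u) + u * (1 - u)).
Proof.
have [A2 A3] := gf_label_sym.
have eA := (@gf_label_eq 0 0 1 1 erefl); have eC := (@gf_label_eq 0 0 0 0 erefl).
have eB1 := (@gf_label_eq 0 1 0 0 erefl); have eB2 := (@gf_label_eq 0 0 1 0 erefl).
have eB3 := (@gf_label_eq 0 0 0 1 erefl); have eN := gfN_mul.
rewrite /= !gf_label_shift A2 A3 -/A in eA eC eB1 eB2 eB3.
exact: (label_system_solution eA eC eB1 eB2 eB3 eN).
Qed.

Lemma theta_1B k (f : fps R) : theta (1 - k%:R * f) = - (k%:R * theta f).
Proof.
by rewrite thetaD (theta_nat _ 1) thetaN thetaM theta_nat mul0r !add0r.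
Qed.

(** Implicit differentiation of [z = u (1 - u)^2]. *)
Lemma theta_gfU : theta u = u * (1 - u) * p.
Proof.
have dz : theta u * (1 - u) * (1 - 3%:R * u) = u * (1 - u) * (1 - u).
  rewrite -z_eq -[in RHS]theta_monomial z_eq.
  by rewrite thetaM [theta (u * _)]thetaM -[u in 1 - u]mul1r (theta_1B 1); ring.
transitivity (theta u * (T * (1 - u)) * (p * (1 - 3%:R * u))).
  by rewrite gfT_inv gfP_inv !mulr1.
transitivity (T * p * (theta u * (1 - u) * (1 - 3%:R * u))); first by ring.
rewrite dz; transitivity ((T * (1 - u)) * (u * (1 - u) * p)); first by ring.
by rewrite gfT_inv mul1r.
Qed.

Lemma theta_gfP : theta p = 3%:R * p ^+ 3 * (u * (1 - u)).
Proof.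
have := congr1 (@theta R) gfP_inv.
rewrite (theta_nat _ 1) thetaM theta_1B theta_gfU => dp.
transitivity (theta p * (p * (1 - 3%:R * u))); first by rewrite gfP_inv mulr1.
apply/eqP; rewrite -subr_eq0; apply/eqP.
by rewrite -[RHS](mulr0 p) -dp; ring.
Qed.

(** The hypergeometric equation of [1/(1 - 3u)]; in terms of coefficients it
    is the quotient of consecutive binomial coefficients [C(3n, n)]. *)
Lemma gfP_ode : 2%:R * (2%:R * theta (theta p) - theta p) =
  3%:R * z * (9%:R * theta (theta p) + 9%:R * theta p + 2%:R * p).
Proof.
have tt : theta (theta p) = 27%:R * p ^+ 5 * (u * (1 - u)) ^+ 2
    + 3%:R * p ^+ 4 * (1 - 2%:R * u) * (u * (1 - u)).
  rewrite {1}theta_gfP thetaM [theta (3%:R * _)]thetaM theta_nat mul0r add0r.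
  rewrite !exprS expr0 mulr1 [theta (p * _)]thetaM [theta (p * _)]thetaM.
  rewrite [theta (u * _)]thetaM -[X in 1 - X]mul1r (theta_1B 1) theta_gfP theta_gfU.
  by ring.
rewrite tt theta_gfP z_eq.
(* Homogenised in p by powers of p (1 - 3u) = 1, this is a polynomial identity *)
have homog x : x = p * (1 - 3%:R * u) ->
  2%:R * (2%:R * (27%:R * p ^+ 5 * (u * (1 - u)) ^+ 2
    + 3%:R * p ^+ 4 * (1 - 2%:R * u) * (u * (1 - u)) * x)
    - 3%:R * p ^+ 3 * (u * (1 - u)) * x ^+ 2) =
  3%:R * (u * (1 - u) * (1 - u)) *
   (9%:R * (27%:R * p ^+ 5 * (u * (1 - u)) ^+ 2
    + 3%:R * p ^+ 4 * (1 - 2%:R * u) * (u * (1 - u)) * x)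
    + 9%:R * (3%:R * p ^+ 3 * (u * (1 - u)) * x ^+ 2) + 2%:R * p * x ^+ 4).
  by move=> ->; ring.
by have := homog 1 (esym gfP_inv); rewrite !expr1n !mulr1.
Qed.

Lemma cf_gfP_rec n : 9%:R * (n.+1%:R * (2 * n + 1)%N%:R) * cf p n.+1 =
  2%:R * ((3 * n + 1)%N%:R * (3 * n + 2)%N%:R) * cf p n.
Proof.
have := congr1 (fun f => cf f n.+1) gfP_ode.
rewrite -[3%:R * z * _]mulrA [cf (3%:R * _) _]cf_natl [cf (2%:R * _) _]cf_natl.
rewrite cf_monomialM cfB cf_natl !cf_theta.
rewrite [cf (_ + 2%:R * p) n]cfD [cf (_ + _) n]cfD !(cf_natl _ _ n) !cf_theta /rho.
move: (cf p n.+1) (cf p n) => q' q ode.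
have nat3 a : (a * n + 1)%N%:R = a%:R * n%:R + 1 :> R by rewrite natrD natrM.
rewrite nat3 (addnS _ 1) nat3; lra.
Qed.

Lemma gfP_sqr : 4%:R * (p * p) = (4%:R - 3%:R * u) * geom R.
Proof.
transitivity (4%:R * (p * p) * ((1 - monomial 1) * geom R)).
  by rewrite mul_geom mulr1.
transitivity ((4%:R * (1 - monomial 1)) * (p * p * geom R)); first by ring.
rewrite one_minus_X.
transitivity ((p * (1 - 3%:R * u)) * (p * (1 - 3%:R * u))
  * (4%:R - 3%:R * u) * geom R).
  by ring.
by rewrite gfP_inv !mul1r.
Qed.

Lemma cf_gfP n : cf p n = (2 * n + 1)%N%:R * cf T n.
Proof. by rewrite cfD cf_natl /=; rewrite natrD natrM; ring. Qed.

End System.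

(** * Values at the dominant singularity *)

Section Values.
Variable R : realType.
Local Notation T := (gfT R).
Local Notation u := (gfU R).
Local Notation p := (gfP R).
Local Notation z := (monomial (rho R)).

Lemma rho_ge0 : 0 <= rho R.
Proof. by rewrite /rho; lra. Qed.

Lemma psum_monomialM c f n : psum (monomial c * f) n.+1 = c * psum f n :> R.
Proof.
by rewrite !psumE -mulrA cf_monomialM.
Qed.

Lemma abs_sums_monomial (c : R) : abs_sums (monomial c) c.
Proof.
have psum1 (a : R) n : psum (monomial a) n.+1 = a.
  rewrite -[monomial a]mulr1 psum_monomialM /psum big_ord_recl big1 //=.
  by rewrite addr0 mulr1.
split; last by rewrite -cvg_shiftS /= (funext (psum1 c)); exact: cvg_cst.
exists `|c| => -[|n]; first by rewrite /psum big_ord1 /= normr0.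
rewrite (_ : fps_norm _ = monomial `|c|) ?psum1 //.
by apply: fpsP => -[|[|k]] //=; rewrite normr0.
Qed.

Lemma cf_gf_ge0 (f : rans -> R) n : (forall G, 0 <= f G) -> 0 <= cf (gf f) n.
Proof. by move=> f0; apply: sumr_ge0 => G _; rewrite mulr_ge0 ?exprn_ge0 ?rho_ge0. Qed.

Lemma cf_gfT_ge0 n : 0 <= cf T n.
Proof. exact: cf_gf_ge0. Qed.

Lemma cf_z_ge0 n : 0 <= cf z n.
Proof. by rewrite /=; case: ifP => // _; exact: rho_ge0. Qed.

Lemma cf_gfU_ge0 n : 0 <= cf u n.
Proof. by apply: cfM_ge0; [apply: cfM_ge0; [exact: cf_z_ge0|]|]; exact: cf_gfT_ge0. Qed.

(** The map [t |-> 1 + rho t^3] preserves [[0, 3/2]]. *)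
Lemma psum_gfT_le n : psum T n <= 3 / 2.
Proof.
have T0 := cf_gfT_ge0; have TT0 := cfM_ge0 T0 T0.
elim: n => [|n IHn].
  rewrite /psum big_ord1 gfT_eq cfD cf_monomialM /=; lra.
rewrite gfT_eq psumD psum_monomialM.
have -> : psum 1 n.+1 = 1 :> R.
  by rewrite /psum big_ord_recl big1 //= addr0.
(* 3/2 is a fixed point of the map, as 4/27 * (3/2)^3 = 1/2 *)
have le3 : psum (T * T * T) n <= psum T n ^+ 3.
  rewrite exprSr expr2; apply: le_trans (psumM_le _ TT0 T0) _.
  by rewrite ler_wpM2r ?psum_ge0 ?psumM_le.
have le27 : psum T n ^+ 3 <= (3 / 2) ^+ 3.
  by rewrite ler_pXn2r ?nnegrE ?psum_ge0 //; lra.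
rewrite /rho; lra.
Qed.

(** The value at the singularity is the double root of [t = 1 + rho t^3]. *)
Lemma abs_sums_gfT : abs_sums T (3 / 2).
Proof.
have [|t Tt] := @abs_sums_norm _ T (3 / 2).
  by move=> n; rewrite (psum_norm_id cf_gfT_ge0) psum_gfT_le.
have tE : t = 1%:R + rho R * (t * t * t).
  apply: (abs_sums_unique Tt); rewrite gfT_eq.
  apply: (abs_sumsD (abs_sums_nat R 1)); apply: abs_sumsM.
    exact: abs_sums_monomial.
  exact: (abs_sumsM (abs_sumsM Tt Tt) Tt).
have t0 : 0 <= t.
  by apply: (ler_cvg_to (cvg_cst 0) Tt.2); near=> n; apply/psum_ge0/cf_gfT_ge0.
have : (2 * t - 3) ^+ 2 * (t + 3) == 0.
  by apply/eqP; move: tE; rewrite /rho !expr2 => tE; lra.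
rewrite mulf_eq0 sqrf_eq0 => /orP[/eqP|/eqP] t3; last by lra.
by rewrite (_ : 3 / 2 = t) //; lra.
Unshelve. all: by end_near. Qed.

Lemma abs_sums_gfU : abs_sums u (1 / 3).
Proof.
rewrite (_ : 1 / 3 = rho R * (3 / 2) * (3 / 2)); last by rewrite /rho; lra.
exact: (abs_sumsM (abs_sumsM (abs_sums_monomial _) abs_sums_gfT) abs_sums_gfT).
Qed.

Lemma psum_gfU_le n : psum u n <= 1 / 3.
Proof.
have [_ uc] := abs_sums_gfU.
rewrite -(cvg_lim _ uc) //; apply: nondecreasing_cvgn_le.
  exact/psum_homo/cf_gfU_ge0.
by apply/cvg_ex; exists (1 / 3).
Qed.

(** The factor [(1 - 3u)^2] of [1 - X] cancels the denominator of the series,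
    so that [(1 - X) A] converges absolutely at 1; the coefficients of [A] are
    its partial sums. *)
Lemma cf_gf_label_cvg : cf (gf_label R 0 1 1) n @[n --> \oo] --> (3 / 44 : R).
Proof.
set A := gf_label R 0 1 1.
pose Y := 4%:R * (1 - monomial 1) * A.
pose G := (4%:R - 3%:R * u) * (u * T) *
  ((1%:R + 2%:R * u * u) * (1%:R - 3%:R * u) + u * (1%:R - u)).
have u3 := abs_sums_gfU.
have nat k := abs_sums_nat R k.
have k9 : abs_sums (- (2%:R * u * u)) (- (2%:R * (1 / 3) * (1 / 3))).
  exact: (abs_sumsN (abs_sumsM (abs_sumsM (nat 2) u3) u3)).
have Gs : abs_sums G ((4%:R - 3%:R * (1 / 3)) * (1 / 3 * (3 / 2)) *
  ((1%:R + 2%:R * (1 / 3) * (1 / 3)) * (1%:R - 3%:R * (1 / 3))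
    + 1 / 3 * (1%:R - 1 / 3))).
  apply: abs_sumsM; first apply: abs_sumsM.
  - exact: (abs_sumsB (nat 4) (abs_sumsM (nat 3) u3)).
  - exact: (abs_sumsM u3 abs_sums_gfT).
  apply: abs_sumsD; last exact: (abs_sumsM u3 (abs_sumsB (nat 1) u3)).
  apply: abs_sumsM; last exact: (abs_sumsB (nat 1) (abs_sumsM (nat 3) u3)).
  exact: (abs_sumsD (nat 1) (abs_sumsM (abs_sumsM (nat 2) u3) u3)).
have YE : Y = G + - (2%:R * u * u) * Y.
  apply: subr0_eq; rewrite /Y one_minus_X.
  have := gf_label011_eq R; rewrite -/A /= => /eqP; rewrite -subr_eq0 => /eqP E.
  rewrite -(mulr0 (4%:R - 3%:R * u)) -[in RHS]E /G; ring.
have [|//|t Yt] := abs_sums_contract Gs (_ : forall n, _ <= 2 / 9) _ YE.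
- move=> n.
  have -> : fps_norm (- (2%:R * u * u)) = 2%:R * (u * u).
    apply: fpsP => k; rewrite -mulrA cf_norm cfN normrN.
    rewrite cf_natl ger0_norm //.
    by rewrite mulr_ge0 // cfM_ge0 //; exact: cf_gfU_ge0.
  rewrite psumE -mulrA cf_natl -psumE.
  have := psumM_le n cf_gfU_ge0 cf_gfU_ge0.
  have := psum_gfU_le n; have := psum_ge0 n cf_gfU_ge0; nra.
- lra.
have tE : t = 3 / 11.
  have := abs_sumsD Gs (abs_sumsM k9 Yt); rewrite -YE.
  by move/(abs_sums_unique Yt) => tE; lra.
have A4 : cf A = fun n => 4^-1 * psum Y n.
  apply/funext => n; rewrite psumE.
  have -> : Y * geom R = 4%:R * (((1 - monomial 1) * geom R) * A) by rewrite /Y; ring.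
  by rewrite mul_geom mul1r cf_natl mulKf.
rewrite A4 (_ : 3 / 44 = 4^-1 * t); last by rewrite tE; lra.
by apply: cvgMr; exact: Yt.2.
Qed.

Lemma cf_gfP_sqr_cvg : cf (p * p) n @[n --> \oo] --> (3 / 4 : R).
Proof.
have PE : cf (p * p) = fun n => 4^-1 * psum (4%:R - 3%:R * u) n.
  by apply/funext => n; rewrite psumE -gfP_sqr cf_natl mulKf.
have := abs_sumsB (abs_sums_nat R 4) (abs_sumsM (abs_sums_nat R 3) abs_sums_gfU).
case=> _ c; rewrite PE (_ : 3 / 4 = 4^-1 * (4%:R - 3%:R * (1 / 3))); last by lra.
by apply: cvgMr; exact: c.
Qed.
End Values.

(** * Central binomial coefficients and Wallis' formula *)

Section Wallis.
Variable R : realType.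

(** The primitive of [cos ^ n] that vanishes at 0, by the reduction formula. *)
Fixpoint cos_prim (n : nat) : R -> R :=
  match n with
  | 0 => id
  | 1 => sin
  | (n'.+1 as n1).+1 =>
      n1.+1%:R^-1 *: ((cos ^+ n1) * sin + n1%:R *: (cos_prim n' : R -> R))
  end.

Lemma nat_ind2 (P : nat -> Prop) :
  P 0 -> P 1 -> (forall n, P n -> P n.+2) -> forall n, P n.
Proof.
move=> P0 P1 P2 n; suff [] : P n /\ P n.+1 by [].
by elim: n => // n [IH IH1]; split => //; apply: P2.
Qed.

Lemma cos_prim_derive n (x : R) : is_derive x 1 (cos_prim n) (cos x ^+ n).
Proof.
elim/nat_ind2: n x => [||n IHn] x.
- by rewrite expr0; exact: is_derive_id.
- by rewrite expr1; exact: is_derive_sin.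
have IHx := IHn x.
apply: is_derive_eq.
rewrite /= fctE /GRing.scale /=.
have s2 : sin x ^+ 2 = 1 - cos x ^+ 2 by have := cos2Dsin2 x; lra.
rewrite [X in _ * X](_ : _ = n.+2%:R * cos x ^+ n.+2) ?mulKf ?pnatr_eq0 //.
transitivity (cos x ^+ n * (cos x ^+ 2 + n.+1%:R * (1 - sin x ^+ 2))).
  by rewrite exprS; ring.
by rewrite s2 -(natr1 n.+1) !exprS; ring.
Qed.

(** [\int_0^(pi/2) cos ^ n] *)
Definition wallis n : R := cos_prim n (pi / 2).

Lemma wallisSS n : wallis n.+2 = n.+1%:R / n.+2%:R * wallis n.
Proof.
rewrite /wallis /= !fctE /GRing.scale /=.
by rewrite cos_pihalf exprS !mul0r add0r mulrA [_^-1 * _]mulrC.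
Qed.

Lemma cos_prim0 n : cos_prim n 0 = 0.
Proof.
elim/nat_ind2: n => [//||n IHn]; first exact: sin0.
by rewrite /= !fctE /GRing.scale /= IHn sin0 !mulr0 addr0 mulr0.
Qed.

(** The difference of the primitives increases, since [cos ^ n.+1 <= cos ^ n]
    between 0 and [pi / 2]. *)
Lemma wallis_le n : wallis n.+1 <= wallis n.
Proof.
have df (x : R) :
    is_derive x 1 (cos_prim n - cos_prim n.+1) (cos x ^+ n - cos x ^+ n.+1).
  by apply: is_deriveB; exact: cos_prim_derive.
have pi2 : 0 <= pi / 2 :> R by rewrite divr_ge0 ?pi_ge0.
suff : (cos_prim n - cos_prim n.+1) 0 <= (cos_prim n - cos_prim n.+1) (pi / 2).
  rewrite -[leLHS]/(cos_prim n 0 - cos_prim n.+1 0) !cos_prim0 subrr.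
  by rewrite -[leRHS]/(wallis n - wallis n.+1) subr_ge0.
apply: (@ger0_derive1_ndecr _ _ 0 (pi / 2)) => //; [move=> x|].
- rewrite in_itv /= => /andP[x0 xpi]; rewrite derive1E derive_val subr_ge0.
  rewrite exprS ler_piMl ?cos_le1 // exprn_ge0 // cos_ge0_pihalf //.
  by rewrite (ltW xpi) andbT (le_trans _ (ltW x0)) // oppr_le0.
- apply: derivable_within_continuous => x _; by have [] := df x.
Qed.

(** The normalised central binomial coefficients ['C(2n, n) / 4 ^ n]. *)
Fixpoint cbin (n : nat) : R :=
  if n is n'.+1 then (2 * n' + 1)%N%:R / (2 * n' + 2)%N%:R * cbin n' else 1.

Lemma cbin_gt0 n : 0 < cbin n.
Proof. by elim: n => //= n IHn; rewrite mulr_gt0 ?divr_gt0 ?ltr0n ?addn1 ?addn2. Qed.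

Lemma wallis_even n : wallis n.*2 = pi / 2 * cbin n.
Proof.
elim: n => [|n IHn]; first by rewrite mulr1.
by rewrite doubleS wallisSS IHn /= -mul2n addn1 addn2; ring.
Qed.

Lemma wallis_odd n : wallis n.*2.+1 = ((2 * n + 1)%N%:R * cbin n)^-1.
Proof.
elim: n => [|n IHn]; first by rewrite /wallis /= sin_pihalf mulr1 invr1.
rewrite doubleS wallisSS IHn /= -mul2n mulnS.
have := cbin_gt0 n; move: (cbin n) => c c0.
have -> : (2 + 2 * n + 1 = 2 * n + 3)%N by lia.
rewrite -addn2 -addn3 !(natrD _ (2 * n)) natrM.
have n0 : 0 <= n%:R :> R by [].
field; rewrite (gt_eqF c0) /=; do ?[apply/andP; split=> //]; rewrite gt_eqF //; lra.
Qed.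

(** Wallis: the integrals of [cos ^ m] decrease in [m], the even ones are
    proportional to [cbin n] and the odd ones to its inverse, which encloses
    [cbin n ^+ 2]. *)
Lemma cbin_sqr_cvg : n%:R * cbin n ^+ 2 @[n --> \oo] --> (pi^-1 : R).
Proof.
have pi0 : 0 < pi :> R := pi_gt0 R.
have lo n : pi^-1 * (1 - n.+1%:R^-1) <= n%:R * cbin n ^+ 2.
  have := wallis_le n.*2; rewrite wallis_odd wallis_even natrD natrM -(natr1 n).
  have := cbin_gt0 n; have : 0 <= n%:R :> R by [].
  move: (cbin n) (n%:R) pi pi0 => c m P P0 m0 c0.
  have d0 : 0 < 2 * m + 1 by lra.
  have d1 : 0 < m + 1 by lra.
  rewrite -[_^-1]mul1r ler_pdivrMr ?mulr_gt0 // => h.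
  have -> : P^-1 * (1 - (m + 1)^-1) = m * (P * (m + 1))^-1 :> R.
    by field; rewrite !gt_eqF.
  rewrite ler_wpM2l // -[_^-1]mul1r ler_pdivrMr ?mulr_gt0 //.
  have : 0 <= P * c ^+ 2 by rewrite mulr_ge0 ?sqr_ge0 // ltW.
  by nra.
have hi n : n%:R * cbin n ^+ 2 <= pi^-1.
  have := wallis_le n.*2.+1; rewrite -doubleS wallis_odd wallis_even /=.
  rewrite !(natrD _ (2 * n)) natrM.
  have := cbin_gt0 n; have : 0 <= n%:R :> R by [].
  move: (cbin n) (n%:R) pi pi0 => c m P P0 m0 c0.
  have d0 : 0 < 2 * m + 1 by lra.
  rewrite -[leRHS]mul1r ler_pdivlMr ?mulr_gt0 //.
  have -> : P / 2 * ((2 * m + 1) / (2 * m + 2) * c) * ((2 * m + 1) * c) =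
      P * c ^+ 2 * ((2 * m + 1) ^+ 2 / (4 * m + 4)) :> R.
    by field; rewrite !gt_eqF //; lra.
  have m_le : m <= (2 * m + 1) ^+ 2 / (4 * m + 4) by rewrite ler_pdivlMr; nra.
  rewrite -[P^-1]mul1r ler_pdivlMr // => h; apply: le_trans h.
  rewrite (_ : _ * P = P * c ^+ 2 * m); last by ring.
  by rewrite ler_wpM2l // mulr_ge0 ?sqr_ge0 // ltW.
apply: (squeeze_cvgr (f := fun n => pi^-1 * (1 - n.+1%:R^-1)) (h := fun=> pi^-1)).
- by near=> n; rewrite lo hi.
- suff : pi^-1 * (1 - n.+1%:R^-1) @[n --> \oo] --> (pi^-1 * (1 - 0) : R).
    by rewrite subr0 mulr1.
  by apply: cvgMr; apply: cvgB; [exact: cvg_cst | exact: cvg_harmonic].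
- exact: cvg_cst.
Unshelve. all: by end_near. Qed.

Lemma sqrt_cvg (f : nat -> R) (l : R) : f n @[n --> \oo] --> l ->
  Num.sqrt (f n) @[n --> \oo] --> Num.sqrt l.
Proof. by move=> fl; apply: (cvg_comp _ _ fl); exact: sqrt_continuous. Qed.

Lemma cbin_cvg0 : cbin n @[n --> \oo] --> (0 : R).
Proof.
have sqr0 : cbin n.+1 ^+ 2 @[n --> \oo] --> (pi^-1 * 0 : R).
  have -> : (fun n => cbin n.+1 ^+ 2) =
      (fun n => (n.+1%:R * cbin n.+1 ^+ 2) * n.+1%:R^-1).
    by apply/funext => n; rewrite mulrAC divff ?mul1r ?pnatr_eq0.
  apply: cvgM; last exact: cvg_harmonic.
  by rewrite (cvg_shiftS (fun n => n%:R * cbin n ^+ 2)); exact: cbin_sqr_cvg.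
have := sqrt_cvg sqr0; rewrite mulr0 sqrtr0.
rewrite (_ : (fun n => _) = [sequence cbin n.+1]_n) ?(cvg_shiftS cbin) //.
by apply/funext => n; rewrite /= sqrtr_sqr ger0_norm // ltW // (cbin_gt0 n.+1).
Qed.

(** [(1 - X) Q^2] is killed by the Euler operator, hence [Q = (1 - X)^(-1/2)]. *)
Lemma cbin_sqr : Fps cbin * Fps cbin = geom R.
Proof.
set Q := Fps cbin; set X : fps R := monomial 1.
have ode : 2%:R * ((1 - X) * theta Q) = X * Q.
  apply: fpsP => -[|n]; rewrite mulrBl mul1r cf_natl cfB !cf_monomialM !cf_theta.
    by rewrite mul0r subrr mulr0.
  rewrite /= !(natrD _ (2 * n)) natrM -(natr1 n).
  by have n0 : 0 <= n%:R :> R by []; field; rewrite gt_eqF //; lra.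
have tD : theta ((1 - X) * (Q * Q)) = 0.
  transitivity (Q * (2%:R * ((1 - X) * theta Q) - X * Q)).
    rewrite thetaM (thetaM Q) thetaD thetaN (theta_nat R 1) theta_monomial -/X; ring.
  by rewrite ode subrr mulr0.
have D1 : (1 - X) * (Q * Q) = 1.
  apply: fpsP => -[|n].
    rewrite mulrBl mul1r cfB cf_monomialM subr0 cfM big_ord1 /=.
    by rewrite mulr1.
  have := congr1 (fun f => cf f n.+1) tD.
  by rewrite cf_theta => /eqP; rewrite mulf_eq0 pnatr_eq0 => /eqP.
transitivity (((1 - X) * geom R) * (Q * Q)); first by rewrite mul_geom mul1r.
transitivity (((1 - X) * (Q * Q)) * geom R); first by ring.
by rewrite D1 mul1r.
Qed.

(** The coefficients of [(f - l q) h] are transforms of the null sequence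
    [r k - l] by the matrix [cf q k * cf h (n - k)]. *)
Lemma conv_ratio (f q h : fps R) (r : nat -> R) (l M : R) :
  (forall n, cf f n = r n * cf q n) -> r n @[n --> \oo] --> l ->
  (forall n, 0 <= cf q n) -> (forall n, 0 <= cf h n) ->
  (forall n, cf (q * h) n <= M) -> cf h n @[n --> \oo] --> 0 ->
  cf (f * h) n - l * cf (q * h) n @[n --> \oo] --> 0.
Proof.
move=> fE rl q0 h0 qhM hc.
have -> : (fun n => cf (f * h) n - l * cf (q * h) n) =
    (fun n => \sum_(k < n.+1) (cf q k * cf h (n - k)) * (r k - l)).
  apply/funext => n; rewrite !cfM mulr_sumr -sumrB; apply: eq_bigr => k _.
  by rewrite fE; ring.
apply: (@toeplitz _ (fun n k => cf q k * cf h (n - k)) (fun k => r k - l) M).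
- move=> n; apply: le_trans (qhM n); rewrite cfM.
  by apply: ler_sum => k _; rewrite ger0_norm // mulr_ge0.
- move=> k; suff : cf q k * cf h (n - k)%N @[n --> \oo] --> cf q k * 0.
    by rewrite mulr0.
  apply: cvgMr; rewrite -(cvg_shiftn k).
  by under eq_fun do rewrite addnK.
- by rewrite -(subrr l); apply: cvgB => //; apply: cvg_cst.
Qed.

(** With [Q = (1 - X)^(-1/2)], all coefficients of [Q^2] are 1; replacing its
    factors by [p] multiplies the limit by [l] each time. *)
Lemma conv_sqr_ratio (p : fps R) (r : nat -> R) (l : R) :
  (forall n, cf p n = r n * cbin n) -> (forall n, 0 <= r n <= 1) ->
  r n @[n --> \oo] --> l ->
  cf (p * p) n @[n --> \oo] --> l * l.
Proof.
move=> pE r01 rl; set q := Fps cbin.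
have q0 n : 0 <= cf q n by rewrite ltW // cbin_gt0.
have p0 n : 0 <= cf p n by rewrite pE mulr_ge0 //; case/andP: (r01 n).
have pq n : cf p n <= cf q n by rewrite pE ler_piMl //; case/andP: (r01 n).
have qq n : cf (q * q) n = 1 by rewrite cbin_sqr.
have qp1 n : cf (q * p) n <= 1.
  rewrite -(qq n) !cfM; apply: ler_sum => k _; exact: ler_wpM2l.
have qc : cf q n @[n --> \oo] --> (0 : R) by exact: cbin_cvg0.
have pc : cf p n @[n --> \oo] --> (0 : R).
  apply: (squeeze_cvgr (f := fun=> 0) (h := cf q)) => //; last exact: cvg_cst.
  by near=> n; rewrite p0 pq.
(* First replacement: from Q^2 to Q p *)
have qpc : cf (q * p) n @[n --> \oo] --> l.
  have -> : cf (q * p) = fun n => (cf (p * q) n - l * cf (q * q) n) + l.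
    by apply/funext => n; rewrite qq mulr1 subrK mulrC.
  suff : (cf (p * q) n - l * cf (q * q) n) + l @[n --> \oo] --> 0 + l.
    by rewrite add0r.
  apply: cvgD; last exact: cvg_cst.
  by apply: (@conv_ratio p q q r l 1) => // n; rewrite qq.
have -> : cf (p * p) = fun n => (cf (p * p) n - l * cf (q * p) n) + l * cf (q * p) n.
  by apply/funext => n; rewrite subrK.
suff : (cf (p * p) n - l * cf (q * p) n) + l * cf (q * p) n @[n --> \oo] --> 0 + l * l.
  by rewrite add0r.
apply: cvgD; last exact: cvgMr.
exact: (@conv_ratio p q p r l 1).
Unshelve. all: by end_near. Qed.
End Wallis.

(** * Asymptotics of the mean distance *)

Section MeanDistance.
Variable R : realType.
Local Notation T := (gfT R).
Local Notation p := (gfP R).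

Definition binom_ratio n : R := cf p n / cbin R n.

Lemma cf_gfP_gt0 n : 0 < cf p n.
Proof.
have n0 k : 0 <= k%:R :> R by [].
elim: n => [|n IHn].
  by rewrite cf_gfP cf_gfT0 mulr1.
have rec := cf_gfP_rec R n.
have : 0 < 9%:R * (n.+1%:R * (2 * n + 1)%N%:R) * cf p n.+1.
  by rewrite rec !mulr_gt0 // ltr0n ?addn1 ?addn2.
by rewrite pmulr_rgt0 // !mulr_gt0 // ltr0n addn1.
Qed.

(** Consecutive ratios compare as [4 (3n+1) (3n+2) <= 9 (2n+1)^2]. *)
Lemma binom_ratio_le n : binom_ratio n.+1 <= binom_ratio n.
Proof.
rewrite /binom_ratio ler_pdivrMr ?cbin_gt0 // mulrAC ler_pdivlMr ?cbin_gt0 //.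
rewrite [cbin _ n.+1]/=.
have p0 := cf_gfP_gt0 n; have c0 := cbin_gt0 R n.
have := cf_gfP_rec R n.
rewrite !(natrD _ (_ * n)) !natrM -(natr1 n).
have : 0 <= n%:R :> R by [].
move: (cf p n) p0 (cf p n.+1) (cbin R n) c0 (n%:R) => q q0 q' c c0 m m0 rec.
have -> : q' = 2 * ((3 * m + 1) * (3 * m + 2)) / (9 * ((m + 1) * (2 * m + 1))) * q.
  rewrite mulrAC -rec mulrC mulKf // gt_eqF // !mulr_gt0 //; lra.
rewrite (_ : q * _ = (2 * m + 1) / (2 * m + 2) * q * c); last by ring.
rewrite !ler_wpM2r ?(ltW c0) ?(ltW q0) // ler_pdivlMr; last by lra.
by rewrite mulrAC ler_pdivrMr ?mulr_gt0 //; lra.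
Qed.

Lemma binom_ratio_ge0 n : 0 <= binom_ratio n.
Proof. by rewrite divr_ge0 // ltW ?cf_gfP_gt0 ?cbin_gt0. Qed.

(** The limit is determined by the value 3/4 of [(1 - X) P^2] at 1. *)
Lemma binom_ratio_cvg : binom_ratio n @[n --> \oo] --> Num.sqrt 3 / 2.
Proof.
have dec : nonincreasing_seq binom_ratio by apply/nonincreasing_seqP/binom_ratio_le.
have r0 : binom_ratio 0 = 1.
  by rewrite /binom_ratio divr1 cf_gfP cf_gfT0 mulr1.
have /cvg_ex[l rl] : cvgn binom_ratio.
  apply: nonincreasing_is_cvgn => //; exists 0 => _ [n _ <-].
  exact: binom_ratio_ge0.
have l0 : 0 <= l.
  by apply: (ler_cvg_to (cvg_cst 0) rl); near=> n; exact: binom_ratio_ge0.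
have p2 : cf (p * p) n @[n --> \oo] --> l * l.
  apply: (conv_sqr_ratio (r := binom_ratio)) => // [n|n].
    by rewrite divfK // gt_eqF // cbin_gt0.
  by rewrite binom_ratio_ge0 -r0 dec.
have l2 : l * l = 3 / 4 by apply: (cvg_unique _ p2 (@cf_gfP_sqr_cvg R)).
suff -> : Num.sqrt 3 / 2 = l by [].
have -> : 3 = (2 * l) ^+ 2 :> R by rewrite expr2; lra.
by rewrite sqrtr_sqr ger0_norm; [lra | rewrite mulr_ge0].
Unshelve. all: by end_near. Qed.

Lemma mean_distanceE n : mean_distance R n.+1 =
  cf (gf_label R 0 1 1) n.+1 / (n.+1%:R * cf T n.+1).
Proof.
have rn : rho R ^+ n.+1 != 0 by rewrite expf_neq0 // /rho mulf_neq0 ?invr_neq0.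
have -> : cf T n.+1 = rho R ^+ n.+1 * (rans_count n.+1)%:R.
  rewrite -[LHS]/(\sum_(G : rans_of n.+1) rho R ^+ n.+1 * 1).
  by rewrite sumr_const mulr1 mulr_natr.
have -> : cf (gf_label R 0 1 1) n.+1 =
    rho R ^+ n.+1 * \sum_(G : rans_of n.+1) (total_distance (val G))%:R.
  by rewrite mulr_sumr; apply: eq_bigr => G _; rewrite total_distanceE.
rewrite /mean_distance [n.+1%:R * (rho R ^+ _ * _)]mulrCA -mulf_div divff // mul1r.
by rewrite mulrC.
Qed.

Lemma mean_distance_scaled n : mean_distance R n.+1 / Num.sqrt n.+1%:R =
  cf (gf_label R 0 1 1) n.+1 * (2 + n.+1%:R^-1)
  / (binom_ratio n.+1 * Num.sqrt (n.+1%:R * cbin R n.+1 ^+ 2)).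
Proof.
rewrite mean_distanceE.
have c0 := cbin_gt0 R n.+1; have p0 := cf_gfP_gt0 n.+1.
rewrite sqrtrM // sqrtr_sqr ger0_norm ?(ltW c0) // /binom_ratio.
move: p0; rewrite cf_gfP natrD natrM.
have s0 : 0 < Num.sqrt n.+1%:R :> R by rewrite sqrtr_gt0.
have : 0 < n.+1%:R :> R by [].
move: (n.+1%:R) s0 (cbin R n.+1) c0 => m s0 c c0 m0.
move: (Num.sqrt m) s0 (cf (gf_label R 0 1 1) n.+1) (cf T n.+1) => s s0 A t.
have d0 : 0 < 2 * m + 1 by lra.
rewrite pmulr_rgt0 // => t0.
by field; rewrite !gt_eqF.
Qed.

Lemma mean_distance_sqrt_cvg :
  mean_distance R n / Num.sqrt n%:R @[n --> \oo] --> Num.sqrt (3 * pi) / 11.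
Proof.
rewrite -(cvg_shiftS (fun n => mean_distance R n / Num.sqrt n%:R)).
rewrite (funext mean_distance_scaled).
have pi0 : 0 < pi :> R := pi_gt0 R.
have s3 : 0 < Num.sqrt 3 :> R by rewrite sqrtr_gt0.
have sp : 0 < Num.sqrt pi :> R by rewrite sqrtr_gt0.
have -> : Num.sqrt (3 * pi) / 11 =
    3 / 44 * (2 + 0) / (Num.sqrt 3 / 2 * Num.sqrt pi^-1) :> R.
  rewrite sqrtrM // sqrtrV ?ltW //.
  have := sqr_sqrtr (ler0n R 3).
  move: (Num.sqrt 3) s3 (Num.sqrt pi) sp => a a0 b b0 a2.
  have -> : 3 / 44 = a ^+ 2 / 44 by rewrite a2.
  by field; rewrite !gt_eqF.
apply: cvgM.
  apply: cvgM.
    by rewrite (cvg_shiftS (cf (gf_label R 0 1 1))); exact: cf_gf_label_cvg.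
  by apply: cvgD; [exact: cvg_cst | exact: cvg_harmonic].
apply: cvgV.
  by rewrite gt_eqF // !mulr_gt0 // sqrtr_gt0 invr_gt0.
apply: cvgM; first by rewrite (cvg_shiftS binom_ratio); exact: binom_ratio_cvg.
apply: sqrt_cvg; rewrite (cvg_shiftS (fun n => n%:R * cbin R n ^+ 2)).
exact: cbin_sqr_cvg.
Qed.
End MeanDistance.

Theorem proposition3p3 (R : realType) :
  (fun n : nat => mean_distance R n : R^o)
  ~_\oo
  (fun n : nat => Num.sqrt (3 * pi) / 11 * Num.sqrt n%:R : R^o).
Proof.
have : 0 < Num.sqrt (3 * pi) / 11 :> R.
  by rewrite divr_gt0 // sqrtr_gt0 mulr_gt0 ?pi_gt0.
have := @mean_distance_sqrt_cvg R.
move: (Num.sqrt (3 * pi) / 11 : R) => K limK K0.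
apply/eqaddoP => eps eps0.
have dist_le := cvgr_dist_le _ _ limK _ (mulr_gt0 eps0 K0).
near=> n.
have s0 : 0 < Num.sqrt n%:R :> R.
  by rewrite sqrtr_gt0 ltr0n; near: n; exists 1%N.
rewrite -[X in `|X|]/(mean_distance R n - K * Num.sqrt n%:R).
rewrite -[mean_distance R n](divfK (lt0r_neq0 s0)) -mulrBl !normrM mulrA.
rewrite ler_wpM2r // distrC (gtr0_norm K0).
by near: n; exact: dist_le.
Unshelve. all: by end_near. Qed.
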